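(* Let $\|\cdot\|:\ell^\infty\to[0,\infty)$ be a monotonic norm satisfying the following two conditions: (A1) $\displaystyle\lim_{n\to\infty}\sup_{j\in\mathbb{N}}\frac1n\sum_{k=1}^{n}|a_{k+j-1}|\le\|a\|$ for all $a\in\ell^\infty$; (A2) there exists a constant $C\ge1$ such that $\|a\|\le\|a\|_\infty\le C\|a\|$ for all $a\in\ell^\infty$. Then every complex-valued Banach limit $L:\ell^\infty\to\mathbb{C}$ satisfies $$|L(a)|\le\|a\|\qquad\text{for all } a\in\ell^\infty .$$
   Context: $\mathbb{N}=\{1,2,3,\dots\}$. $\ell^\infty$ is the complex Banach space of bounded complex sequences with the uniform norm $\|\cdot\|_\infty$, and $c$ is the subspace of convergent complex sequences. A norm $\|\cdot\|$ on $\ell^\infty$ is called monotonic if for all $a,b\in\ell^\infty$ with $|a_k|\le|b_k|$ for all $k\in\mathbb{N}$ one has $\|a\|\le\|b\|$. $B:\ell^\infty\to\ell^\infty$ is the backward shift $(a_1,a_2,\dots)\mapsto(a_2,a_3,\dots)$, $\mathbb{1}=(1,1,\dots)$, and $a\ge0$ means $a_k\ge0$ for all $k$. A (complex-valued) Banach limit is a linear functional $L:\ell^\infty\to\mathbb{C}$ such that: (1) $L(a)=L(Ba)$ for all $a\in\ell^\infty$; (2) $L(a)\ge0$ for all $a\in\ell^\infty$ with $a\ge0$; (3) $L(\mathbb{1})=1$ and $|L(a)|\le\|a\|_\infty$ for all $a\in\ell^\infty$; (4) $L(a)=\lim_{n\to\infty}a_n$ for all $a\in c$. (The limit in (A1)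 exists for every bounded sequence.) *)

(* Defs.v *)
From HB Require Import structures.
From mathcomp Require Import all_boot all_order all_algebra.
From mathcomp Require Import complex.
From mathcomp Require Import all_classical all_reals all_analysis.

Set Implicit Arguments.
Unset Strict Implicit.
Unset Printing Implicit Defensive.

Import Order.TTheory GRing.Theory Num.Theory.
Import numFieldNormedType.Exports.
Import ComplexField.Normc.

Local Open Scope classical_set_scope.
Local Open Scope ring_scope.
Local Open Scope complex_scope.

(* [normc z] is the modulus of z : R[i] as an element of R (whereas `|z| is
   the same number as an element of R[i]). *)

(* Sequences are indexed from 0: the term a_k of (a_1, a_2, ...) is [a k.-1]. *)
Definition bounded_cseq (R : realType) : pred (nat -> R[i]) :=
  fun a => `[< exists M : R, forall k, normc (a k) <= M >].

Lemma bounded_cseqP (R : realType) (a : nat -> R[i]) :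
  reflect (exists M : R, forall k, normc (a k) <= M) (a \in @bounded_cseq R).
Proof. exact: asboolP. Qed.

Lemma bounded_cseq_submod_closed (R : realType) :
  submod_closed (@bounded_cseq R).
Proof.
split=> [|z a b /bounded_cseqP[M aM] /bounded_cseqP[N bN]].
  by apply/bounded_cseqP; exists 0 => k; rewrite normc0.
apply/bounded_cseqP; exists (normc z * M + N) => k.
have normc_ge0 : 0 <= normc z by case: (z) => x y; exact: sqrtr_ge0.
apply: (le_trans (le_normcD _ _)); apply: lerD (bN k).
by rewrite normcM ler_wpM2l.
Qed.

HB.instance Definition _ (R : realType) := GRing.isSubmodClosed.Build R[i]
  (nat -> R[i]) (@bounded_cseq R) (@bounded_cseq_submod_closed R).

Record linfty (R : realType) : Type := LInfty {
  linfty_val :> nat -> R[i] ;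
  linfty_valP : linfty_val \in @bounded_cseq R }.

HB.instance Definition _ (R : realType) := [isSub for @linfty_val R].
HB.instance Definition _ (R : realType) := gen_eqMixin (linfty R).
HB.instance Definition _ (R : realType) := gen_choiceMixin (linfty R).
HB.instance Definition _ (R : realType) :=
  [SubChoice_isSubLmodule of linfty R by <:].

Definition sup_norm (R : realType) (a : linfty R) : R :=
  sup (range (fun k => normc (a k))).

Lemma bshift_subproof (R : realType) (a : linfty R) :
  (fun k => a k.+1) \in @bounded_cseq R.
Proof.
have /bounded_cseqP[M aM] := linfty_valP a.
by apply/bounded_cseqP; exists M.
Qed.

Definition bshift (R : realType) (a : linfty R) : linfty R :=
  LInfty (bshift_subproof a).

Lemma linfty1_subproof (R : realType) :
  (fun=> 1 : R[i]) \in @bounded_cseq R.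
Proof. by apply/bounded_cseqP; exists (normc 1). Qed.

Definition linfty1 (R : realType) : linfty R := LInfty (linfty1_subproof R).

Record is_norm (R : realType) (N : linfty R -> R) : Prop := IsNorm {
  is_norm_ge0 : forall a, 0 <= N a ;
  is_norm_eq0 : forall a, N a = 0 -> a = 0 ;
  is_normZ : forall (z : R[i]) a, N (z *: a) = normc z * N a ;
  is_normD : forall a b, N (a + b) <= N a + N b }.

Definition monotonic_norm (R : realType) (N : linfty R -> R) : Prop :=
  forall a b : linfty R, (forall k, normc (a k) <= normc (b k)) -> N a <= N b.

(* For n >= 1, sup_j (1/n) * sum_(k = 1)^n |a_(k+j-1)|. The junk value at n = 0
   is irrelevant to the limit n -> oo. *)
Definition sup_mean (R : realType) (a : linfty R) (n : nat) : R :=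
  sup (range (fun j => n%:R^-1 * \sum_(k < n) normc (a (k + j)%N))).

(* In R[i], 0 <= z means that z is real and nonnegative. The alias (R[i])^o
   is the type that carries the usual topology of C. *)
Record banach_limit (R : realType) (L : {scalar linfty R}) : Prop :=
  BanachLimit {
  banach_limit_shift : forall a, L a = L (bshift a) ;
  banach_limit_ge0 : forall a : linfty R, (forall k, 0 <= a k) -> 0 <= L a ;
  banach_limit1 : L (linfty1 R) = 1 ;
  banach_limit_le_norm : forall a, normc (L a) <= sup_norm a ;
  banach_limit_lim : forall a : linfty R, cvgn (a : nat -> (R[i])^o) ->
    L a = limn (a : nat -> (R[i])^o) }.

(* Main.v *)
Require Import Defs.
From mathcomp Require Import all_boot all_order all_algebra.
From mathcomp Require Import complex.
From mathcomp Require Import all_classical all_reals all_analysis.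
From mathcomp Require Import lra.
Import Order.TTheory GRing.Theory Num.Theory.
Import numFieldNormedType.Exports.
Import ComplexField.Normc.
Local Open Scope classical_set_scope.
Local Open Scope ring_scope.

(** A Banach limit L is shift invariant, so for every n >= 1 it takes the same
    value at a and at the average
      m = n^-1 (a + B a + ... + B^(n-1) a),  where B is the shift.
    As L is bounded by the uniform norm,
      |L a| = |L m| <= ||m||_oo <= sup_j n^-1 (|a_j| + ... + |a_(j+n-1)|),
    which is [normc_banach_limit_le_sup_mean]; the right-hand side is the n-th
    term of the sequence whose limit is bounded by N a. Letting n tend to
    infinity gives the theorem.

    The passage to the limit requires that this sequence converge. It does by
    Fekete's lemma, [fekete]: the supremum over j of the sums of n consecutive
    terms of |a| is a subadditive function of n, because a block of length m + n
    splits into one of length m followed by one of length n. *)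

Section Fekete.
Variables (R : realType) (u : nat -> R).
Hypothesis u_subadd : forall m n, u (m + n)%N <= u m + u n.

Lemma subadditive_mulnD q m r : u (q * m + r)%N <= q%:R * u m + u r.
Proof.
elim: q => [|q IHq]; first by rewrite mul0n add0n mul0r add0r.
rewrite mulSn -addnA (le_trans (u_subadd _ _))//.
by rewrite -natr1 mulrDl mul1r (addrC _ (u m)) -addrA lerD2l.
Qed.

(** With n = q m + r and r < m, the term q * u m differs from n * (u m / m) by
    r * (u m / m), and u r is at most r * u 1 + u 0: both are bounded in n. *)
Lemma subadditive_le_linear m : (0 < m)%N ->
  exists K, forall n, u n <= n%:R * (u m / m%:R) + K.
Proof.
move=> m_gt0; set s := u m / m%:R.
exists (m%:R * (`|s| + `|u 1|) + u 0) => n.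
have ms : u m = m%:R * s by rewrite mulrC divfK// pnatr_eq0 -lt0n.
have r_le : (n %% m)%:R <= m%:R :> R by rewrite ler_nat ltnW// ltn_mod.
have un := subadditive_mulnD (n %/ m) m (n %% m).
have ur := subadditive_mulnD (n %% m) 1 0.
rewrite -divn_eq ms in un; rewrite muln1 addn0 in ur.
rewrite {2}(divn_eq n m) natrD natrM.
have rs : - ((n %% m)%:R * s) <= m%:R * `|s|.
  rewrite -mulrN -normrN (le_trans (ler_wpM2l _ (ler_norm _)))//.
  by rewrite ler_wpM2r.
have r1 : (n %% m)%:R * u 1 <= m%:R * `|u 1|.
  by rewrite (le_trans (ler_wpM2l _ (ler_norm _)))// ler_wpM2r.
lra.
Qed.

(** Choose m with u m / m close to the infimum: the linear bound above gives
    u n / n <= u m / m + K / n, and K / n tends to 0. *)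
Lemma fekete : has_lbound [set u n / n%:R | n in [set n | (0 < n)%N]] ->
  u n / n%:R @[n --> \oo] --> inf [set u n / n%:R | n in [set n | (0 < n)%N]].
Proof.
set E := [set _ | _ in _] => E_lb; apply/cvgrPdist_lt => e e_gt0.
have E_inf : has_inf E by split => //; exists (u 1 / 1%:R), 1%N.
have e2_gt0 : 0 < e / 2 by rewrite divr_gt0.
have [_ [m m_gt0 <-] m_lt] := inf_adherent e2_gt0 E_inf.
have [K uK] := subadditive_le_linear _ m_gt0.
near=> n.
have n_gt0 : (0 < n)%N by near: n; exact: nbhs_infty_gt.
have nR_gt0 : 0 < n%:R :> R by rewrite ltr0n.
have inf_le : inf E <= u n / n%:R by apply: ge_inf => //; exists n.
rewrite ler0_norm ?subr_le0// opprB.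
have K_lt : K / (e / 2) + 1 <= n%:R by near: n; exact: nbhs_infty_ger.
have Kn : K / n%:R < e / 2.
  rewrite ltr_pdivrMr// mulrC -ltr_pdivrMr//.
  by rewrite (lt_le_trans _ K_lt)// ltrDl.
have un : u n / n%:R <= u m / m%:R + K / n%:R.
  have -> : u m / m%:R + K / n%:R = (n%:R * (u m / m%:R) + K) / n%:R.
    by rewrite mulrDl mulrAC divff ?gt_eqF// mul1r.
  by rewrite ler_pM2r ?invr_gt0.
lra.
Unshelve. all: by end_near. Qed.

End Fekete.

Section SupMean.
Variable R : realType.
Implicit Types a : linfty R.

Lemma normc_ge0 (z : R[i]) : 0 <= normc z.
Proof. by case: z => x y; exact: sqrtr_ge0. Qed.

Lemma normc_sum (I : Type) (r : seq I) (P : pred I) (F : I -> R[i]) :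
  normc (\sum_(i <- r | P i) F i) <= \sum_(i <- r | P i) normc (F i).
Proof.
elim/big_ind2: _ => [|x1 y1 x2 y2 xy1 xy2|//]; first by rewrite normc0.
by rewrite (le_trans (le_normcD _ _))// lerD.
Qed.

Lemma mean_le_sup_mean a n j :
  n%:R^-1 * \sum_(k < n) normc (a (k + j)%N) <= sup_mean a n.
Proof.
have /bounded_cseqP[M aM] := linfty_valP a.
apply: ub_le_sup; last by exists j.
exists (n%:R^-1 * \sum_(k < n) M) => _ [i _ <-].
by rewrite ler_wpM2l ?invr_ge0// ler_sum.
Qed.

Lemma sup_mean_le a n M :
  (forall j, n%:R^-1 * \sum_(k < n) normc (a (k + j)%N) <= M) ->
  sup_mean a n <= M.
Proof.
by move=> aM; apply: ge_sup => [|_ [j _ <-]//]; eexists; exists 0%N.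
Qed.

Lemma sum_le_sup_mean a n j :
  \sum_(k < n) normc (a (k + j)%N) <= n%:R * sup_mean a n.
Proof.
have [->|n_gt0] := posnP n; first by rewrite big_ord0 mul0r.
by rewrite mulrC -ler_pdivrMr ?ltr0n// mulrC mean_le_sup_mean.
Qed.

Lemma sup_mean_subadditive a m n :
  (m + n)%:R * sup_mean a (m + n)
    <= m%:R * sup_mean a m + n%:R * sup_mean a n.
Proof.
have [/eqP|mn_gt0] := posnP (m + n).
  by rewrite addn_eq0 => /andP[/eqP-> /eqP->]; rewrite !mul0r addr0.
rewrite mulrC -ler_pdivlMr ?ltr0n//; apply: sup_mean_le => j.
rewrite mulrC ler_pM2r ?invr_gt0 ?ltr0n// big_split_ord/=.
apply: lerD; first exact: sum_le_sup_mean.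
under eq_bigr => k _ do rewrite -addnA addnCA.
exact: sum_le_sup_mean.
Qed.

(** Fekete's lemma applies to n * sup_mean a n, the supremum of the unnormalised
    sums; dividing by n gives back sup_mean a n as soon as n > 0. *)
Lemma is_cvg_sup_mean a : cvgn (sup_mean a).
Proof.
have meanE n : (0 < n)%N -> n%:R * sup_mean a n / n%:R = sup_mean a n.
  by move=> n_gt0; rewrite mulrAC divff ?mul1r// pnatr_eq0 -lt0n.
apply/cvg_ex; eexists; apply: cvg_trans; last first.
  apply: (fekete _ (fun n => n%:R * sup_mean a n)).
    exact: sup_mean_subadditive.
  exists 0 => _ [n n_gt0 <-]; rewrite meanE//.
  apply: le_trans (mean_le_sup_mean a n 0).
  by rewrite mulr_ge0 ?invr_ge0// sumr_ge0// => k _; exact: normc_ge0.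
by apply: near_eq_cvg; near=> n; rewrite meanE//; near: n; exact: nbhs_infty_gt.
Unshelve. all: by end_near. Qed.

End SupMean.

Section BanachLimit.
Variable R : realType.
Implicit Types a : linfty R.

Lemma iter_bshiftE a n j : iter n (@bshift R) a j = a (n + j)%N.
Proof. by elim: n j => // n IHn j; rewrite iterS /= IHn addnS. Qed.

Definition shift_mean a n : linfty R :=
  (n%:R^-1 : R[i]) *: \sum_(k < n) iter k (@bshift R) a.

Lemma shift_meanE a n j :
  shift_mean a n j = n%:R^-1 * \sum_(k < n) a (k + j)%N.
Proof.
rewrite -[LHS]/(n%:R^-1 * linfty_val _ j); congr (_ * _).
rewrite (big_morph (fun b : linfty R => b j) (id1 := 0) (op1 := +%R))//.
by apply: eq_bigr => k _; exact: iter_bshiftE.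
Qed.

Lemma sup_norm_shift_mean a n : sup_norm (shift_mean a n) <= sup_mean a n.
Proof.
apply: ge_sup => [|_ [j _ <-]]; first by eexists; exists 0%N.
apply: le_trans (mean_le_sup_mean R a n j).
rewrite shift_meanE normcM normcV normcMn normc1.
by rewrite ler_wpM2l ?invr_ge0// normc_sum.
Qed.

(** Every one of the n shifted sequences has the same image L a. *)
Lemma banach_limit_shift_mean (L : {scalar linfty R}) a n :
  banach_limit L -> (0 < n)%N -> L (shift_mean a n) = L a.
Proof.
move=> limL n_gt0; rewrite linearZ linear_sum/=.
have LB k : L (iter k (@bshift R) a) = L a.
  by elim: k => // k <-; rewrite iterS -banach_limit_shift.
under eq_bigr do rewrite LB.
by rewrite sumr_const card_ord -[L a *+ n]mulr_natl mulKf// pnatr_eq0 -lt0n.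
Qed.

Lemma normc_banach_limit_le_sup_mean (L : {scalar linfty R}) a n :
  banach_limit L -> (0 < n)%N -> normc (L a) <= sup_mean a n.
Proof.
move=> limL n_gt0; rewrite -(banach_limit_shift_mean L a n limL n_gt0).
by rewrite (le_trans (banach_limit_le_norm limL _))// sup_norm_shift_mean.
Qed.

End BanachLimit.

Theorem theorem5p1 (R : realType) (N : linfty R -> R)
  (normN : is_norm N) (monoN : monotonic_norm N)
  (A1 : forall a : linfty R, limn (sup_mean a) <= N a)
  (A2 : exists2 C : R, 1 <= C &
    forall a : linfty R, N a <= sup_norm a /\ sup_norm a <= C * N a)
  (L : {scalar linfty R}) (limL : banach_limit L) :
  forall a : linfty R, normc (L a) <= N a.
Proof.
move=> a; apply: le_trans (A1 a); apply: limr_ge; first exact: is_cvg_sup_mean.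
near=> n; apply: normc_banach_limit_le_sup_mean => //.
by near: n; exact: nbhs_infty_gt.
Unshelve. all: by end_near. Qed.
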